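(* Let $n\in\mathbb{N}$ and let $\zeta_n$ be a primitive $n$-th root of unity. For all $l,s\in\mathbb{Z}_{\geq 0}$, the sum $$W_n^1(l,s)=\sum_{\substack{d_0+d_1+\cdots+d_s=l\\ d_0,\ldots,d_s\geq 0}}z_n\left(\{1\}^{d_0},2,\{1\}^{d_1},2,\ldots,2,\{1\}^{d_s};\zeta_n\right)$$ (in which the entry $2$ occurs exactly $s$ times) satisfies $$W_n^1(l,s)=\frac{(-1)^s}{n(s+1)}\binom{s+l}{l}\binom{n+s}{2s+l+1}(1-\zeta_n)^{2s+l}.$$
   Context: $\mathbb{N}$ is the set of positive integers. For $n\in\mathbb{N}$, a complex number $q$ with $q^m\neq 1$ for all $m\in\mathbb{N}$ with $m<n$, and a multi-index $(k_1,\ldots,k_d)\in\mathbb{N}^d$, the finite multiple harmonic $q$-series is $$z_n(k_1,\ldots,k_d;q)=\sum_{n>m_1>\cdots>m_d>0}\frac{q^{(k_1-1)m_1+\cdots+(k_d-1)m_d}}{[m_1]^{k_1}\cdots[m_d]^{k_d}},\qquad [m]=\frac{1-q^m}{1-q},$$ where $m_1,\dots,m_d$ are integers. An empty sum is $0$, and for the empty multi-index ($d=0$) one sets $z_n(\emptyset;q)=1$. The notation $\{a\}^{m}$ means $a$ repeated $m$ times. Binomial coefficients $\binom{a}{b}$ with integers $a\ge 0$ are $0$ if $b<0$ or $b>a$; $0^0=1$. *)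

(* Defs.v *)
From mathcomp Require Import all_boot all_order all_algebra.
From mathcomp Require Import reals complex.

Set Implicit Arguments.
Unset Strict Implicit.
Unset Printing Implicit Defensive.

Import GRing.Theory.

Local Open Scope ring_scope.

Definition qint (C : fieldType) (q : C) (m : nat) : C := (1 - q ^+ m) / (1 - q).

(* [path gtn n m && all (ltn 0) m] says n > m_1 > ... > m_d > 0, so that taking
   the m_i in 'I_n loses nothing. *)
Definition zq (C : fieldType) (n : nat) (k : seq nat) (q : C) : C :=
  \sum_(m : (size k).-tuple 'I_n |
          path gtn n (map val m) && all (ltn 0) (map val m))
    q ^+ (\sum_(i < size k) (nth 0 k i - 1) * tnth m i)%N
      / \prod_(i < size k) qint q (tnth m i) ^+ nth 0%N k i.

(* ({1}^{d_0}, 2, {1}^{d_1}, 2, ..., 2, {1}^{d_s}) for d = (d_0, ..., d_s) *)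
Definition ones_twos (d : seq nat) : seq nat :=
  nseq (head 0%N d) 1%N ++ flatten [seq 2%N :: nseq e 1%N | e <- behead d].

(* Each d_i is at most l since d_0 + ... + d_s = l. *)
Definition W1 (C : fieldType) (n l s : nat) (q : C) : C :=
  \sum_(d : s.+1.-tuple 'I_l.+1 | (\sum_(i < s.+1) tnth d i == l)%N)
    zq n (ones_twos (map val d)) q.

(* Main.v *)
(* Writing u_m = zeta^m, the generating function of W_n^1(l,s) (1-zeta)^(-2s-l) in
   a (for l) and b (for s) is the product over 0 < m < n of
   1 + a/(1-u_m) + b u_m/(1-u_m)^2 = (u_m^2 - P u_m + Q)/(1-u_m)^2, where
   P = 2+a-b and Q = 1+a.  At u = 1 the quadratic takes the value b, so with M its
   companion matrix, b n^2 times the generating function is det(M^n - 1), i.e.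
   Q^n + 1 - V_n with V_n = tr M^n the Lucas sequence of (P,Q).  Since
   dV_n/db = -n U_n, where U_n is the other Lucas sequence, the coefficient of
   a^l b^s is [a^l b^s] U_n / (n(s+1)), and U_(n+2) = P U_(n+1) - Q U_n gives
   [a^l b^s] U_n = (-1)^s C(s+l,l) C(n+s,2s+l+1) by Pascal's rule. *)
Require Import Defs.
From mathcomp Require Import all_boot all_order all_algebra.
From mathcomp Require Import reals complex.
From mathcomp Require Import ring zify.

Import GRing.Theory.

Local Open Scope ring_scope.

(** * Reindexing sums over tuples *)

Lemma big_tuple_cons (V : nmodType) (T : finType) (n : nat)
    (P : pred (n.+1.-tuple T)) (F : n.+1.-tuple T -> V) :
  \sum_(t | P t) F t =
    \sum_(x : T) \sum_(t : n.-tuple T | P [tuple of x :: t]) F [tuple of x :: t].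
Proof.
rewrite pair_big_dep /=.
rewrite (reindex (fun p : T * n.-tuple T => [tuple of p.1 :: p.2])) //.
exists (fun t => (thead t, [tuple of behead t])) => [[x t]|t] _ /=.
  by congr (_, _); apply: val_inj.
by rewrite -tuple_eta.
Qed.

Lemma big_tuple0 (V : nmodType) (T : finType)
    (P : pred (0.-tuple T)) (F : 0.-tuple T -> V) :
  \sum_(t | P t) F t = if P [tuple] then F [tuple] else 0.
Proof.
by rewrite big_mkcond (big_pred1 [tuple]) // => t; apply/esym/eqP; apply: tuple0.
Qed.

(** * The nested sums as a recursion on the largest index *)

Section MultipleHarmonicSums.

Variables (C : fieldType) (q : C).

Definition zterm (k m : nat) : C := q ^+ ((k - 1) * m) / qint q m ^+ k.

Fixpoint zrec (k : seq nat) (n : nat) : C :=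
  if k is k1 :: k' then \sum_(m < n | (0 < m)%N) zterm k1 m * zrec k' m else 1.

Lemma zterm_prod (k : seq nat) (N : nat) (m : (size k).-tuple 'I_N) :
  q ^+ (\sum_(i < size k) (nth 0 k i - 1) * tnth m i)%N
      / \prod_(i < size k) qint q (tnth m i) ^+ nth 0%N k i =
  \prod_(i < size k) zterm (nth 0%N k i) (tnth m i).
Proof.
by rewrite expr_sum prodf_div.
Qed.

(** The index type ['I_N] stays fixed while the bound [n] drops to the chosen m_1, hence two
    separate bounds. *)
Lemma zrecE (k : seq nat) (n N : nat) : (n <= N)%N ->
  \sum_(m : (size k).-tuple 'I_N |
          path gtn n (map val m) && all (ltn 0) (map val m))
     \prod_(i < size k) zterm (nth 0%N k i) (tnth m i) = zrec k n.
Proof.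
elim: k n => [|k1 k IHk] n le_nN /=.
  by rewrite big_tuple0 /= big_ord0.
rewrite big_tuple_cons (big_ord_widen_cond N (ltn 0) (fun m => zterm k1 m * zrec k m)) //.
rewrite [RHS]big_mkcond; apply: eq_bigr => x _ /=.
case: (ltnP x n) => [lt_xn|_]; last by rewrite big_pred0 // andbF.
case: (posnP x) => [_|x_gt0] /=.
  by rewrite big_pred0 // => t; rewrite andbF.
rewrite -IHk; last by apply: leq_trans le_nN; apply: ltnW.
rewrite big_distrr; apply: eq_bigr => t _ /=.
rewrite big_ord_recl /=; congr (_ * _).
by apply: eq_bigr => i _; rewrite [in LHS](tnth_nth x) [in RHS](tnth_nth x).
Qed.

Lemma zq_zrec (n : nat) (k : seq nat) : zq n k q = zrec k n.
Proof.
rewrite -(zrecE k n n (leqnn n)); apply: eq_bigr => m _; exact: zterm_prod.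
Qed.

Lemma zrec_cons (k1 : nat) (k : seq nat) (n : nat) :
  zrec (k1 :: k) n.+1 =
    zrec (k1 :: k) n + (if (0 < n)%N then zterm k1 n * zrec k n else 0).
Proof. by rewrite /= big_mkcond big_ord_recr /= -big_mkcond. Qed.

End MultipleHarmonicSums.

Arguments zterm {C} q k m.
Arguments zrec {C} q k n.

(** * Sums over words with s letters 2 and l letters 1 *)

Section WordSums.

Variable C : fieldType.

(* Sum of [f] over the words {2,1^{d_1},...,2,1^{d_s}} with d_1 + ... + d_s = l. *)
Fixpoint bsum (s l : nat) (f : seq nat -> C) : C :=
  if s is s'.+1 then
    \sum_(i < l.+1) bsum s' (l - i) (fun w => f (2%N :: nseq i 1%N ++ w))
  else if l is 0 then f [::] else 0.

Definition wsum (s l : nat) (f : seq nat -> C) : C :=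
  \sum_(i < l.+1) bsum s (l - i) (fun w => f (nseq i 1%N ++ w)).

(** As in [zrecE], [N] is kept apart from [l], which drops to [l - i] in the induction. *)
Lemma bsumE (s l N : nat) (f : seq nat -> C) : (l <= N)%N ->
  \sum_(d : s.-tuple 'I_N.+1 | (\sum_(i < s) tnth d i == l)%N)
    f (flatten [seq 2%N :: nseq e 1%N | e <- map val d]) = bsum s l f.
Proof.
elim: s l f => [|s IHs] l f le_lN.
  by rewrite big_tuple0 big_ord0 /=; case: l {le_lN}.
rewrite big_tuple_cons /=.
rewrite (big_ord_widen N.+1 (fun i => bsum s (l - i) (fun w => f (2%N :: nseq i 1%N ++ w)))) //.
rewrite [RHS]big_mkcond; apply: eq_bigr => x _.
have sumE (t : s.-tuple 'I_N.+1) :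
    (\sum_(i < s.+1) tnth [tuple of x :: t] i = x + \sum_(i < s) tnth t i)%N.
  rewrite big_ord_recl; congr (_ + _)%N.
  by apply: eq_bigr => i _; rewrite [in LHS](tnth_nth x) [in RHS](tnth_nth x).
case: ltnP => [le_xl|lt_lx].
  rewrite -IHs; last exact: leq_trans (leq_subr _ _) le_lN.
  apply: eq_bigl => t; rewrite sumE -(eqn_add2l x (\sum_(i < s) _)%N) subnKC //.
rewrite big_pred0 // => t; rewrite sumE; apply/negbTE; rewrite neq_ltn.
by rewrite (leq_trans lt_lx (leq_addr _ _)) orbT.
Qed.

Lemma wsumE (s l : nat) (f : seq nat -> C) :
  \sum_(d : s.+1.-tuple 'I_l.+1 | (\sum_(i < s.+1) tnth d i == l)%N)
    f (ones_twos (map val d)) = wsum s l f.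
Proof.
rewrite big_tuple_cons; apply: eq_bigr => x _.
have le_xl : (x <= l)%N by rewrite -ltnS.
rewrite -(bsumE _ _ l) ?leq_subr //.
apply: eq_bigl => t; rewrite big_ord_recl /=.
rewrite -(eqn_add2l x (\sum_(i < s) _)%N) subnKC //; congr (x + _ == _)%N.
by apply: eq_bigr => i _; rewrite [in LHS](tnth_nth x) [in RHS](tnth_nth x).
Qed.

Lemma bsumD (s l : nat) (f g : seq nat -> C) (a : C) :
  bsum s l (fun w => f w + a * g w) = bsum s l f + a * bsum s l g.
Proof.
elim: s l f g => [|s IHs] [|l] f g //=; rewrite ?mulr0 ?addr0 //.
  by rewrite !big_ord1 IHs.
by rewrite big_distrr -big_split; apply: eq_bigr => i _ /=; rewrite IHs.
Qed.

Lemma wsumD (s l : nat) (f g : seq nat -> C) (a : C) :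
  wsum s l (fun w => f w + a * g w) = wsum s l f + a * wsum s l g.
Proof.
rewrite big_distrr -big_split; apply: eq_bigr => i _ /=; exact: bsumD.
Qed.

Lemma eq_bsum (s l : nat) (f g : seq nat -> C) :
  f =1 g -> bsum s l f = bsum s l g.
Proof.
elim: s l f g => [|s IHs] l f g eq_fg; first by case: l => /=.
by apply: eq_bigr => i _; apply: IHs => w; apply: eq_fg.
Qed.

Lemma eq_wsum (s l : nat) (f g : seq nat -> C) :
  f =1 g -> wsum s l f = wsum s l g.
Proof. by move=> eq_fg; apply: eq_bigr => i _; apply: eq_bsum => w; apply: eq_fg. Qed.

Lemma bsum0 (s l : nat) : bsum s l (fun=> 0) = 0.
Proof. by elim: s l => [|s IHs] [|l] //=; rewrite big1. Qed.

Lemma wsum0 (s l : nat) : wsum s l (fun=> 0) = 0.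
Proof. by rewrite /wsum big1 // => i _; apply: bsum0. Qed.

(** If d_0 = 0 the word is empty or begins with 2; otherwise it begins with 1. *)
Lemma wsum_first (s l : nat) (f : seq nat -> C) :
  wsum s l f = (if s is s'.+1 then wsum s' l (fun w => f (2%N :: w))
                else if l is 0 then f [::] else 0)
    + (if l is l'.+1 then wsum s l' (fun w => f (1%N :: w)) else 0).
Proof.
rewrite {1}/wsum big_ord_recl subn0; congr (_ + _); first by case: s.
case: l => [|l]; first by rewrite big_ord0.
by apply: eq_bigr => i _.
Qed.

Variable q : C.

Lemma wsum_zrec1 (s l : nat) :
  wsum s l (fun k => zrec q k 1) = ((s == 0) && (l == 0))%N%:R.
Proof.
(* No index satisfies 0 < m < 1, so nonempty words contribute 0. *)
have w0 k1 s' l' : wsum s' l' (fun k => zrec q (k1 :: k) 1) = 0.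
  by rewrite -(wsum0 s' l'); apply: eq_wsum => k; rewrite /= big_mkcond big_ord1.
by rewrite wsum_first; case: s => [|s]; case: l => [|l]; rewrite ?w0 /= ?addr0.
Qed.

(** The new terms are those with m_1 = n; they use up the first letter and leave the rest of the
    word with bound [n]. *)
Lemma wsum_zrecS (s l n : nat) : (0 < n)%N ->
  wsum s l (fun k => zrec q k n.+1) = wsum s l (fun k => zrec q k n)
    + (if s is s'.+1 then zterm q 2 n * wsum s' l (fun k => zrec q k n) else 0)
    + (if l is l'.+1 then zterm q 1 n * wsum s l' (fun k => zrec q k n) else 0).
Proof.
move=> n_gt0.
have wS k1 s' l' : wsum s' l' (fun k => zrec q (k1 :: k) n.+1) =
    wsum s' l' (fun k => zrec q (k1 :: k) n)
      + zterm q k1 n * wsum s' l' (fun k => zrec q k n).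
  by rewrite -wsumD; apply: eq_wsum => k; rewrite zrec_cons n_gt0.
rewrite 2!(wsum_first s l).
case: s => [|s]; case: l => [|l]; rewrite ?wS ?addr0 //=; ring.
Qed.

End WordSums.

Arguments wsum {C} s l f.

(** * The generating function as a finite product *)

Section GeneratingFunction.

Variables (C : fieldType) (q : C).

(* The outer variable ['X] marks the entries 2, the inner one the entries 1; the
   powers of [1 - q] are left out. *)
Definition genfun (n : nat) : {poly {poly C}} :=
  \prod_(1 <= m < n) (1 + ((1 - q ^+ m)^-1 *: 'X)%:P
                        + (q ^+ m / (1 - q ^+ m) ^+ 2)%:P%:P * 'X).

(** The recurrence [wsum_zrecS] is multiplication by one more factor of the product. A letter k
    contributes k powers of 1 - q, coming from 1/[m]^k. *)
Lemma wsum_zrec_genfun (s l n : nat) : (0 < n)%N ->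
  wsum s l (fun k => zrec q k n) = (genfun n)`_s`_l * (1 - q) ^+ (2 * s + l).
Proof.
case: n => // n _; elim: n s l => [|n IHn] s l.
  rewrite wsum_zrec1 /genfun big_geq // coef1.
  case: s => [|s]; last by rewrite coef0 mul0r.
  by rewrite coef1; case: l => [|l]; rewrite /= ?mul0r // mul1r.
rewrite wsum_zrecS // /genfun big_nat_recr //= -/(genfun n.+1).
set u := q ^+ n.+1; set v := (1 - u)^-1.
have zt1 : zterm q 1 n.+1 = v * (1 - q).
  by rewrite /zterm subnn mul0n expr0 expr1 /qint invf_div mul1r mulrC.
have zt2 : zterm q 2 n.+1 = u / (1 - u) ^+ 2 * (1 - q) ^+ 2.
  by rewrite /zterm mul1n -exprVn /qint invf_div exprMn exprVn -/u mulrA mulrAC.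
rewrite mulrDr mulrDr mulr1 mulrA !coefD !coefMC coefMX coefMC zt1 zt2.
rewrite -scalerAr coefZ coefMX.
case: s => [|s]; case: l => [|l]; rewrite ?IHn ?coefMC ?coef0 //=; rewrite -/v.
- ring.
- by rewrite !addnS !exprS; ring.
- by rewrite !mulnS /= !addSn !exprS; ring.
- by rewrite !mulnS /= !addSn !addnS !exprS; ring.
Qed.

End GeneratingFunction.

Arguments genfun {C} q n.

(** * Lucas sequences and the companion matrix *)

Lemma det_mx22 (K : comNzRingType) (A : 'M[K]_2) :
  \det A = A 0 0 * A 1 1 - A 0 1 * A 1 0.
Proof.
rewrite (expand_det_row A 0) !big_ord_recl big_ord0 addr0 /cofactor !det_mx11 !mxE /=.
rewrite expr0 expr1 mul1r mulN1r mulrN.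
by congr (A _ _ * A _ _ - A _ _ * A _ _); apply: val_inj.
Qed.

Section LucasSequences.

Variables (K : comNzRingType) (P Q : K).

Fixpoint lucasU (n : nat) : K :=
  if n is n1.+1 then
    if n1 is n2.+1 then P * lucasU n1 - Q * lucasU n2 else 1
  else 0.

(** The companion Lucas sequence 2, P, ..., expressed through U. *)
Definition lucasV (n : nat) : K := 2 * lucasU n.+1 - P * lucasU n.

Lemma lucasUSS (n : nat) : lucasU n.+2 = P * lucasU n.+1 - Q * lucasU n.
Proof. by []. Qed.

Definition lucas_mx : 'M[K]_2 :=
  \matrix_(i, j) (if i == 0 then (if j == 0 then 0 else - Q)
                  else (if j == 0 then 1 else P)).

(** The homogeneous form serves both M - u and M^n - 1, as powers of M are linear in M. *)
Lemma det_lucas_mx (a b : K) :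
  \det (a *: lucas_mx - b%:M) = b ^+ 2 - a * P * b + a ^+ 2 * Q.
Proof. by rewrite det_mx22 !mxE /=; ring. Qed.

(** Cayley-Hamilton reduces every power. The exponent starts at 1 because M^0 would call for
    U_(-1). *)
Lemma lucas_mxX (n : nat) :
  lucas_mx ^+ n.+1 = lucasU n.+1 *: lucas_mx - (Q * lucasU n)%:M.
Proof.
elim: n => [|n IHn]; first by rewrite expr1 /= scale1r mulr0 raddf0 subr0.
have sqr_mx : lucas_mx * lucas_mx = P *: lucas_mx - Q%:M.
  apply/matrixP => i j; rewrite !mxE !big_ord_recl big_ord0 !mxE.
  case: i => [[|[|[]]]] // ?; case: j => [[|[|[]]]] // ?; rewrite /= ?mulr1n ?mulr0n; ring.
rewrite exprSr IHn mulrBl -scalerAl sqr_mx lucasUSS.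
have -> : (Q * lucasU n)%:M * lucas_mx = (Q * lucasU n) *: lucas_mx.
  exact: mul_scalar_mx.
by rewrite scalerBr scalerA scale_scalar_mx scalerBl addrAC ![lucasU n.+1 * _]mulrC.
Qed.

(* Both sides are det (M^n - 1) for the companion matrix M of X^2 - P X + Q. *)
Lemma prod_quadratic (r : seq K) (n : nat) :
  \prod_(u <- r) ('X - u%:P) = 'X^n - 1 ->
  \prod_(u <- r) (u ^+ 2 - P * u + Q) = Q ^+ n + 1 - lucasV n.
Proof.
(* Evaluating the factorisation at M and taking determinants turns each root u into the quadratic in
   u. *)
move=> /(congr1 (fun p => \det (horner_mx lucas_mx p))).
rewrite rmorph_prod (big_morph _ (@det_mulmx K 2) (det1 K 2)).
under eq_bigr => u _.
  rewrite rmorphB /= horner_mx_X horner_mx_C -[lucas_mx]scale1r det_lucas_mx.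
  rewrite expr1n !mul1r.
over.
move=> ->; rewrite rmorphB rmorphXn rmorph1 /= horner_mx_X.
have detX : \det lucas_mx = Q.
  by rewrite det_mx22 !mxE /=; ring.
have detXn m : \det (lucas_mx ^+ m) = Q ^+ m.
  by elim: m => [|m IHm]; rewrite ?det1 // !exprS det_mulmx detX IHm.
case: n => [|n].
  by rewrite expr0 subrr det0 /lucasV /=; ring.
(* With the power of Q written as det of the power of M, both sides become quadratic forms in two
   consecutive U's. *)
rewrite -detXn lucas_mxX -addrA -opprD -raddfD !det_lucas_mx /lucasV lucasUSS.
by ring.
Qed.

End LucasSequences.

Arguments lucasU {K} P Q n.
Arguments lucasV {K} P Q n.

Lemma deriv_lucasV (R : comNzRingType) (P Q : {poly R}) (n : nat) :
  P^`() = -1 -> Q^`() = 0 -> (lucasV P Q n)^`() = - n%:R * lucasU P Q n.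
Proof.
move=> dP dQ; rewrite /lucasV.
(* V obeys the same second-order recurrence as U, so the induction carries two consecutive
   indices. *)
suff: (2 * lucasU P Q n.+1 - P * lucasU P Q n)^`() = - n%:R * lucasU P Q n
   /\ (2 * lucasU P Q n.+2 - P * lucasU P Q n.+1)^`() = - n.+1%:R * lucasU P Q n.+1.
  by case.
elim: n => [|n [IH0 IH1]].
  by split; rewrite /= !derivE ?dP; ring.
split=> //.
have -> : 2 * lucasU P Q n.+3 - P * lucasU P Q n.+2 =
    P * (2 * lucasU P Q n.+2 - P * lucasU P Q n.+1) - Q * (2 * lucasU P Q n.+1 - P * lucasU P Q n).
  by rewrite !lucasUSS; ring.
rewrite derivB !derivM IH0 IH1 dP dQ -[n.+1%:R]natr1 -[n.+2%:R]natr1 -[n.+1%:R]natr1 !lucasUSS.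
by ring.
Qed.

(** * Coefficients of U for the particular P and Q *)

Section LucasCoefficients.

Variable C : fieldType.

(** The ['X] under [%:P] is a, the outer one is b: P = 2 + a - b. *)
Definition genP : {poly {poly C}} := (2 + 'X)%:P - 'X.
Definition genQ : {poly {poly C}} := (1 + 'X)%:P.

Lemma coef_genPM (f : {poly {poly C}}) (s l : nat) :
  (genP * f)`_s`_l = 2 * f`_s`_l + (if l is l'.+1 then f`_s`_l' else 0)
    - (if s is s'.+1 then f`_s'`_l else 0).
Proof.
rewrite mulrBl !coefB coefCM coefXM mulrDl coefD coefXM [in LHS]mulr_natl coefMn [in RHS]mulr_natl.
by case: s => [|s]; case: l => [|l]; rewrite ?coef0.
Qed.

Lemma coef_genQM (f : {poly {poly C}}) (s l : nat) :
  (genQ * f)`_s`_l = f`_s`_l + (if l is l'.+1 then f`_s`_l' else 0).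
Proof. by rewrite coefCM mulrDl mul1r coefD coefXM; case: l. Qed.

Lemma coef_lucasU (n s l : nat) :
  (lucasU genP genQ n)`_s`_l =
    (-1) ^+ s * ('C(s + l, l)%:R * 'C(n + s, 2 * s + l + 1)%:R).
Proof.
suff: forall s l,
    (lucasU genP genQ n)`_s`_l =
      (-1) ^+ s * ('C(s + l, l)%:R * 'C(n + s, 2 * s + l + 1)%:R)
 /\ (lucasU genP genQ n.+1)`_s`_l =
      (-1) ^+ s * ('C(s + l, l)%:R * 'C(n.+1 + s, 2 * s + l + 1)%:R).
  by move=> /(_ s l) [].
elim: n {s l} => [|n IHn] s l.
  (* For n = 0, and for n = 1 unless s = l = 0, the lower entry 2s+l+1 exceeds the upper one. *)
  split; first by rewrite !coef0 ['C(_, (_ + 1)%N)]bin_small ?mulr0 //; lia.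
  rewrite coef1; case: s => [|s]; last by rewrite coef0 ['C(_, (_ + 1)%N)]bin_small ?mulr0 //; lia.
  rewrite coef1; case: l => [|l]; first by rewrite !mul1r.
  by rewrite ['C(_, (_ + 1)%N)]bin_small ?mulr0 //; lia.
split; first exact: (IHn s l).2.
rewrite lucasUSS !coefB coef_genPM coef_genQM.
(* The cases with s = 0 or l = 0 lack the neighbours at s - 1 or l - 1. *)
case: s => [|s]; case: l => [|l].
- rewrite !(IHn _ _).1 !(IHn _ _).2 !addn0 !bin0 !bin1 !expr0.
  by rewrite -!natr1; ring.
- rewrite !(IHn _ _).1 !(IHn _ _).2 !add0n !addn0 !binn !expr0 !addn1 !binS !natrD.
  by ring.
- rewrite !(IHn _ _).1 !(IHn _ _).2 !addn0 !bin0 !mulnS !addn1 !addnS !addSn !add0n.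
  by rewrite !binS !natrD !exprS; ring.
rewrite !(IHn _ _).1 !(IHn _ _).2 !mulnS !addn1 !addnS !addSn !add0n.
by rewrite !binS !natrD !exprS; ring.
Qed.

End LucasCoefficients.

(** * Specialisation to a primitive root of unity *)

Section PrimitiveRoot.

Variables (C : fieldType) (n : nat) (z : C).
Hypothesis (z_prim : n.-primitive_root z).

(** Cancel X - 1 in the factorisation of X^n - 1 and evaluate the quotient 1 + X + ... + X^(n-1) at
    1. *)
Lemma prod_subX_prim_root : \prod_(1 <= m < n) (1 - z ^+ m) = n%:R.
Proof.
have n_gt0 := prim_order_gt0 z_prim.
have := factor_Xn_sub_1 z_prim; rewrite big_ltn // expr0 subrX1.
have nz : 'X - 1%:P != 0 :> {poly C} by rewrite polyXsubC_eq0.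
move=> /(mulfI nz) /(congr1 (horner^~ 1)).
rewrite horner_prod horner_sum.
under eq_bigr do rewrite hornerXsubC.
move=> ->; under eq_bigr do rewrite hornerXn expr1n.
by rewrite sumr_const card_ord.
Qed.

(** The factor n^2 clears the denominators (1 - z^m)^2, and ['X] is the quadratic at the remaining
    root 1: 1 - P + Q = b. *)
Lemma genfun_lucasV :
  n%:R ^+ 2 * ('X * genfun z n) = genQ C ^+ n + 1 - lucasV (genP C) (genQ C) n.
Proof.
pose phi : {rmorphism C -> {poly {poly C}}} := polyC \o polyC.
rewrite -(@prod_quadratic _ _ _ [seq phi (z ^+ i) | i <- index_iota 0 n]); last first.
  have := congr1 (map_poly phi) (factor_Xn_sub_1 z_prim).
  rewrite rmorph_prod rmorphB /= map_polyXn rmorph1 big_map => <-.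
  by apply: eq_bigr => i _; rewrite rmorphB /= map_polyX map_polyC.
rewrite big_map big_ltn ?(prim_order_gt0 z_prim) //.
have phi1 : phi (z ^+ 0) = 1 by rewrite expr0 rmorph1.
rewrite phi1 mulrCA; congr (_ * _); first by rewrite /genP /genQ !polyCD polyC1; ring.
have -> : n%:R ^+ 2 = \prod_(1 <= m < n) phi (1 - z ^+ m) ^+ 2 :> {poly {poly C}}.
  by rewrite prodrXl -rmorph_prod prod_subX_prim_root rmorph_nat.
rewrite -big_split /=; apply: eq_big_nat => m /andP[m_gt0 lt_mn].
set u := z ^+ m.
have u_neq1 : 1 - u != 0.
  rewrite subr_eq0 eq_sym -(prim_order_dvd z_prim).
  by rewrite gtnNdvd.
set v := (1 - u)^-1.
have -> : (v *: 'X)%:P = phi v * 'X%:P :> {poly {poly C}}.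
  by rewrite -mul_polyC polyCM.
have -> : (u / (1 - u) ^+ 2)%:P%:P = phi u * phi v ^+ 2.
  by rewrite -rmorphXn -rmorphM /= /v exprVn.
have -> : phi u = 1 - phi (1 - u) by rewrite rmorphB rmorph1; ring.
have phiV : phi (1 - u) * phi v = 1 by rewrite -rmorphM mulfV // rmorph1.
rewrite /genP /genQ !polyCD polyC1.
move: phiV; set w := phi (1 - u); set y := phi v => wy.
(* Grouping the inverse y with w lets w y = 1 remove it. *)
transitivity (w ^+ 2 + w * (w * y) * 'X%:P + (1 - w) * (w * y) ^+ 2 * 'X); first by ring.
by rewrite wy; ring.
Qed.

(** Since Q^n + 1 is constant in b, the coefficient of b^(s+1) gives n^2 [b^s] [genfun] = -[b^(s+1)]
    V. The derivative of V gives (s+1) [b^(s+1)] V = -n [b^s] U, and one n cancels. *)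
Lemma coef_genfun (s l : nat) :
  n%:R * s.+1%:R * (genfun z n)`_s`_l = (lucasU (genP C) (genQ C) n)`_s`_l.
Proof.
have n_neq0 : n%:R != 0 :> C := prim_root_natf_neq0 z_prim.
have genfunE : n%:R * (n%:R * (genfun z n)`_s`_l) =
    - (lucasV (genP C) (genQ C) n)`_s.+1`_l.
  have := congr1 (fun p : {poly {poly C}} => p`_s.+1`_l) genfun_lucasV.
  rewrite /genQ -polyC_exp !coefB coefD coefC coef1 /= addr0 coef0 sub0r => <-.
  by rewrite [in RHS]mulrCA coefXM /= expr2 -mulrA !mulr_natl !coefMn.
have lucasVE : (lucasV (genP C) (genQ C) n)`_s.+1`_l *+ s.+1 =
    - (n%:R * (lucasU (genP C) (genQ C) n)`_s`_l).
  have dP : (genP C)^`() = -1 by rewrite /genP !derivE sub0r.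
  have dQ : (genQ C)^`() = 0 by rewrite /genQ !derivE.
  by rewrite -coefMn -coef_deriv deriv_lucasV // mulNr !coefN !mulr_natl !coefMn.
apply: (mulfI n_neq0); apply: oppr_inj; rewrite -lucasVE -mulr_natl.
by rewrite -[lucasV _ _ _]opprK !coefN -genfunE; ring.
Qed.

End PrimitiveRoot.

Theorem theorem1p1 (R : realType) (n : nat) (zeta : R[i]) (l s : nat)
  (n_gt0 : (0 < n)%N) (zeta_prim : n.-primitive_root zeta) :
  W1 n l s zeta =
    (-1) ^+ s / (n%:R * s.+1%:R) * 'C(s + l, l)%:R * 'C(n + s, 2 * s + l + 1)%:R
      * (1 - zeta) ^+ (2 * s + l).
Proof.
rewrite /W1; under eq_bigr do rewrite zq_zrec.
rewrite (wsumE _ s l (fun k => zrec zeta k n)) wsum_zrec_genfun //.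
congr (_ * _).
(* Characteristic zero makes s + 1 invertible. *)
have ns_neq0 : n%:R * s.+1%:R != 0 :> R[i].
  by rewrite -natrM Num.Theory.pnatr_eq0 muln_eq0 negb_or -!lt0n n_gt0.
apply: (mulfI ns_neq0); rewrite coef_genfun // coef_lucasU.
by field; rewrite nat1r andbC -negb_or -mulf_eq0.
Qed.
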